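(* Let $T$ be a tree of order $n$ with exactly $n_2$ vertices of degree $2$. Then $$b(T)\le \left\lceil \left(n+n_2-\left\lceil\sqrt{n+n_2+0.25}-1.5\right\rceil\right)^{1/2}\right\rceil.$$
   Context: All graphs are finite and simple. Burning process of a connected graph $G$: initially all vertices are unburned. In each round $r\ge 1$, one vertex $x_r$ that is unburned at the end of round $r-1$ is chosen as the source of round $r$; in round $r$ the source $x_r$ becomes burned, and so does every vertex that was unburned at the end of round $r-1$ and is adjacent to a vertex burned at the end of round $r-1$. Burned vertices stay burned. If all vertices are burned at the end of round $k$ (and not earlier), $(x_1,\dots,x_k)$ is called a burning sequence for $G$ of length $k$. The burning number $b(G)$ is the minimum length of a burning sequence for $G$. *)

(* Defs.v *)
From HB Require Import structures.
From mathcomp Require Import all_boot all_order all_algebra.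
From mathcomp Require Import reals.
Set Implicit Arguments. Unset Strict Implicit. Unset Printing Implicit Defensive.

Definition simple_graph (T : finType) (e : rel T) : Prop :=
  symmetric e /\ irreflexive e.

Definition graph_connected (T : finType) (e : rel T) : Prop :=
  forall u v : T, connect e u v.

Definition acyclic (T : finType) (e : rel T) : Prop :=
  forall c : seq T, uniq c -> 2 < size c -> ~~ cycle e c.

Definition is_tree (T : finType) (e : rel T) : Prop :=
  [/\ simple_graph e, 0 < #|T|, graph_connected e & acyclic e].

Definition deg (T : finType) (e : rel T) (v : T) : nat := #|[set u | e v u]|.

Definition n2 (T : finType) (e : rel T) : nat := #|[set v | deg e v == 2]|.

Definition spread (T : finType) (e : rel T) (B : {set T}) : {set T} :=
  B :|: [set v | [exists u in B, e u v]].

Fixpoint burned_from (T : finType) (e : rel T) (B : {set T}) (s : seq T)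
  : {set T} :=
  match s with
  | [::] => B
  | x :: s' => burned_from e (spread e B :|: [set x]) s'
  end.

Fixpoint valid_from (T : finType) (e : rel T) (B : {set T}) (s : seq T)
  : bool :=
  match s with
  | [::] => true
  | x :: s' => (x \notin B) && valid_from e (spread e B :|: [set x]) s'
  end.

Definition burned (T : finType) (e : rel T) (s : seq T) : {set T} :=
  burned_from e set0 s.

Definition burning_seq (T : finType) (e : rel T) (s : seq T) : bool :=
  [&& valid_from e set0 s, burned e s == [set: T]
    & burned e (take (size s).-1 s) != [set: T]].

Definition has_burning_seq_of_length (T : finType) (e : rel T) (k : nat)
  : bool := [exists t : k.-tuple T, burning_seq e t].

(* burning number: least k admitting a burning sequence of length k
   (searched in 0..#|T|; for connected nonempty graphs one always exists) *)
Definition burning_number (T : finType) (e : rel T) : nat :=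
  find (has_burning_seq_of_length e) (iota 0 #|T|.+1).

(* Main.v *)
Require Import Defs.
From HB Require Import structures.
From mathcomp Require Import all_boot all_order all_algebra zify lra.
From mathcomp Require Import reals.
Set Implicit Arguments. Unset Strict Implicit. Unset Printing Implicit Defensive.
Import Order.TTheory GRing.Theory Num.Theory.

(** Write m = n + n_2. The bound on the right-hand side is at most k exactly
    when m < k^2 + k, so k sources have to suffice in that case. Counting edges,
    the set I of vertices of degree at least 2 satisfies 2|I| + 2 <= m, hence
    2|I| < (k - 1)(k + 2), that is, |I| is less than the sum of s + 2 over the
    radii s = 0, ..., k - 2. This suffices for covering I by balls of these
    radii, one of each, and enlarging the radii by one covers the leaves too.

    The covering result holds for every set of distinct radii and every subtree
    A with fewer than sum (s + 2) vertices. One cuts off, with the largest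
    radius r and possibly a second radius m, a part having at least r + 2 (resp.
    r + m + 4) vertices. Let l be a deepest vertex, v its r-th ancestor and p the
    parent of v. The ball around v covers the branch at v, which is large enough
    unless it is a bare path, and even the branch at p unless some other vertex x
    below p has depth at least that of l minus 1; in the remaining cases a
    second, smaller ball at the bottom of a path takes care of what is left. *)

(* [lia] is very slow when the context holds hypotheses outside its scope. *)
Local Ltac nat_lia :=
  repeat match goal with H : ?P |- _ =>
    lazymatch P with
    | is_true (leq _ _) => fail
    | is_true (negb (eq_op _ _)) => fail
    | @eq nat _ _ => fail
    | _ => clear H
    end
  end; lia.

(** * Covering a rooted tree by balls of distinct radii *)

Section RootedTree.

Variables (T : finType) (par : T -> T) (d : T -> nat) (root : T).
Hypothesis d_root : forall x, d x = 0 -> x = root.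
Hypothesis d_par : forall x, d (par x) = (d x).-1.

Implicit Types (A X : {set T}) (x y v : T) (S : seq nat).

(* Distance at most r, measured along the two paths to a common ancestor; no
   harm is done by the iterates getting stuck at the root. *)
Definition near (r : nat) (c x : T) : Prop :=
  exists i j, i + j <= r /\ iter i par x = iter j par c.

(** The branch at [v]. The depths fix the exponent, so membership is decidable; [descP] gives the
    existential form. *)
Definition desc (v : T) : {set T} :=
  [set x | (d v <= d x) && (iter (d x - d v) par x == v)].

Definition par_closed (A : {set T}) : Prop := forall x, x \in A -> par x \in A.

(** Centres are indexed by radius, so each radius provides one ball only. *)
Definition coverable (S : seq nat) (A : {set T}) : Prop :=
  exists c : nat -> T, forall x, x \in A -> exists2 s, s \in S & near s (c s) x.

Lemma d_iter i x : d (iter i par x) = d x - i.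
Proof. by elim: i => [|i IH] /=; rewrite ?subn0 // d_par IH; lia. Qed.

Lemma descP v x : reflect (exists i, iter i par x = v) (x \in desc v).
Proof.
rewrite inE; apply: (iffP andP) => [[_ /eqP <-]|[i <-]]; first by eexists.
rewrite d_iter leq_subr; split=> //; have [le_i|lt_i] := leqP i (d x).
  by rewrite subKn.
(* Beyond depth 0 both iterates are stuck at the root. *)
rewrite (d_root (x := iter i par x)) ?d_iter; last by lia.
by apply/eqP/d_root; rewrite d_iter; lia.
Qed.

Lemma desc_depth v x : x \in desc v -> d v <= d x.
Proof. by rewrite inE => /andP[]. Qed.

Lemma desc_iter v x : x \in desc v -> iter (d x - d v) par x = v.
Proof. by rewrite inE => /andP[_ /eqP]. Qed.

Lemma desc_refl v : v \in desc v.
Proof. by apply/descP; exists 0. Qed.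

Lemma par_desc v x : par x \in desc v -> x \in desc v.
Proof. by move=> /descP[i <-]; apply/descP; exists i.+1; rewrite iterSr. Qed.

Lemma desc_par v x : x \in desc v -> x \in desc (par v).
Proof. by move=> /descP[i <-]; apply/descP; exists i.+1. Qed.

Lemma iter_desc i x : x \in desc (iter i par x).
Proof. by apply/descP; exists i. Qed.

Lemma desc_same_depth u v x :
  d u = d v -> x \in desc u -> x \in desc v -> u = v.
Proof. by move=> duv /desc_iter <- /desc_iter <-; rewrite duv. Qed.

Lemma near_desc r v x : x \in desc v -> d x <= d v + r -> near r v x.
Proof.
by move=> xv dx; exists (d x - d v), 0; rewrite (desc_iter xv); split=> //; lia.
Qed.

(** One unit of radius is spent going up from [v] to its parent. *)
Lemma near_desc_par r v x :
  x \in desc (par v) -> d x < d (par v) + r -> near r v x.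
Proof.
move=> xv dx; exists (d x - d (par v)), 1; rewrite (desc_iter xv).
by split=> //; have := desc_depth xv; lia.
Qed.

Lemma par_closedD A v : par_closed A -> par_closed (A :\: desc v).
Proof.
move=> Acl x; rewrite !inE => /andP[xv xA]; rewrite Acl // andbT.
by apply: contra xv => xv; have := @par_desc v x; rewrite !inE => ->.
Qed.

Lemma par_closed_iter A i x : par_closed A -> x \in A -> iter i par x \in A.
Proof. by move=> Acl xA; elim: i => //= i; apply: Acl. Qed.

Definition chain (k : nat) (x : T) : {set T} := [set iter i par x | i : 'I_k].

Lemma chain_card k x : k <= (d x).+1 -> #|chain k x| = k.
Proof.
move=> kx; rewrite card_imset ?card_ord // => i j /(congr1 d); rewrite !d_iter.
by move=> eq_ij; apply: ord_inj; have := ltn_ord i; have := ltn_ord j; lia.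
Qed.

Lemma chain_sub A v x : par_closed A -> x \in A -> x \in desc v ->
  chain (d x - d v).+1 x \subset A :&: desc v.
Proof.
move=> Acl xA xv; apply/subsetP=> _ /imsetP[i _ ->].
rewrite inE par_closed_iter //=; apply/descP; exists (d x - d v - i).
by rewrite -iterD subnK ?desc_iter // -ltnS.
Qed.

Lemma card_desc_gt A v x : par_closed A -> x \in A -> x \in desc v ->
  d x - d v < #|A :&: desc v|.
Proof.
move=> Acl xA xv; rewrite -(@chain_card (d x - d v).+1 x); last by lia.
exact/subset_leq_card/chain_sub.
Qed.

(** The branch only has room for the path from [x] up to [v], on which a vertex is determined by its
    depth. *)
Lemma desc_chain A v x y : par_closed A -> x \in A -> x \in desc v ->
    #|A :&: desc v| <= (d x - d v).+1 -> y \in A -> y \in desc v ->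
  y = iter (d x - d y) par x.
Proof.
move=> Acl xA xv cA yA yv.
have /eqP eqA : chain (d x - d v).+1 x == A :&: desc v.
  by rewrite eqEcard chain_sub // chain_card // ltnS leq_subr.
have : y \in chain (d x - d v).+1 x by rewrite eqA inE yA.
case/imsetP=> i _ ->; rewrite d_iter subKn //.
by have := ltn_ord i; lia.
Qed.

(** Branches at distinct children are disjoint, and [p] itself makes the inequality strict. The
    condition on depths keeps the root, its own parent, from counting as a child. *)
Lemma card_desc_children A p (W : seq T) : p \in A -> uniq W ->
    (forall w, w \in W -> par w = p /\ d w = (d p).+1) ->
  \sum_(w <- W) #|A :&: desc w| < #|A :&: desc p|.
Proof.
elim: W A => [|w W IH] A pA.
  by rewrite big_nil card_gt0 => _ _; apply/set0Pn; exists p; rewrite inE pA desc_refl.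
rewrite /= big_cons => /andP[wW uW] chW.
have [pw dw] := chW w (mem_head _ _).
have pAw : p \in A :\: desc w.
  by rewrite in_setD pA andbT; apply/negP=> /desc_depth; lia.
have chW' u : u \in W -> par u = p /\ d u = (d p).+1.
  by move=> uW'; apply: chW; rewrite in_cons uW' orbT.
have := IH _ pAw uW chW'.
rewrite (eq_big_seq (fun u => #|A :&: desc u|)) => [lt|u uW'].
  rewrite -(cardsID (desc w) (A :&: desc p)) -addnS leq_add //.
    rewrite subset_leq_card //; apply/subsetP=> x; rewrite !in_setI.
    by case/andP=> -> xw; rewrite xw -pw desc_par.
  apply: leq_trans lt _; rewrite subset_leq_card //; apply/subsetP=> x.
  by rewrite !(in_setI, in_setD) => /andP[/andP[-> ->] ->].
congr #|pred_of_set _|; apply/setP=> x; rewrite !(in_setI, in_setD).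
have [xu|] := boolP (x \in desc u); rewrite ?andbF // !andbT.
have -> // : x \notin desc w; apply: contraNN wW => xw.
have [_ du] := chW' u uW'.
by rewrite (desc_same_depth _ xw xu) // dw du.
Qed.

Lemma desc_child p x : x \in desc p -> d p < d x ->
  exists u, [/\ par u = p, d u = (d p).+1 & x \in desc u].
Proof.
move=> xp dx; exists (iter (d x - d p).-1 par x); split; last exact: iter_desc.
  by rewrite -iterS prednK ?desc_iter // subn_gt0.
by rewrite d_iter; lia.
Qed.

Lemma coverable0 S : coverable S set0.
Proof. by exists (fun=> root) => x; rewrite inE. Qed.

Lemma coverable_ball (r : nat) (S : seq nat) (A X : {set T}) (c0 : T) :
    r \in S -> uniq S -> (forall x, x \in A -> x \in X -> near r c0 x) ->
  coverable (rem r S) (A :\: X) -> coverable S A.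
Proof.
move=> rS uS Xc [c cP]; exists (fun s => if s == r then c0 else c s) => x xA.
have [xX|xX] := boolP (x \in X); first by exists r; rewrite ?eqxx //; apply: Xc.
have [|s sS sx] := cP x; first by rewrite inE xX.
move: sS; rewrite mem_rem_uniq // inE => /andP[/negPf sr sS].
by exists s; rewrite ?sr.
Qed.

(** Induction on the number of radii. [S] is decreasing, so its head is the largest radius; what is
    cut off is large enough for the inequality to hold again for the remaining radii. *)
Lemma tree_cover S A : sorted gtn S -> par_closed A ->
  #|A| < \sum_(s <- S) (s + 2) -> coverable S A.
Proof.
have [n] := ubnP (size S); elim: n S A => // n IH [|r S] A.
  by rewrite big_nil.
rewrite /= ltnS => szS pathS Acl; rewrite big_cons => cardA.
have gtn_trans : transitive gtn by move=> a b c /= ba cb; exact: ltn_trans ba.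
have lt_r (s : nat) : s \in S -> s < r by move/(allP (order_path_min gtn_trans pathS)).
have sortS : sorted gtn S := path_sorted pathS.
have uS : uniq S.
  by apply: (sorted_uniq gtn_trans) sortS => a; rewrite /= ltnn.
(* If no vertex is deeper than [r], one ball around the root suffices. *)
have [/existsP[x0 /andP[x0A dx0]]|shallow] := boolP [exists x in A, r < d x]; last first.
  exists (fun=> root) => x xA; exists r; first exact: mem_head.
  have dx : d x <= r.
    by rewrite leqNgt; apply: contra shallow => lt; apply/existsP; exists x; rewrite xA.
  by exists (d x), 0; rewrite addn0; split=> //; apply: d_root; rewrite d_iter subnn.
have [l lA dmax] : {l | l \in A & forall x, x \in A -> d x <= d l}.
  by case: (arg_maxnP d x0A) => l lA dmax; exists l.
have dl : r < d l := leq_trans dx0 (dmax _ x0A).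
have eat1 u c0 : (forall x, x \in A -> x \in desc u -> near r c0 x) ->
    r + 2 <= #|A :&: desc u| -> coverable (r :: S) A.
  move=> uc cu; apply: (coverable_ball (r := r) (X := desc u)) uc _.
  - exact: mem_head.
  - by rewrite /= uS andbT; apply/negP=> /lt_r; rewrite ltnn.
  rewrite /= eqxx; apply: IH => //; first exact: par_closedD.
  by have := cardsID (desc u) A; nat_lia.
(* The alternative that nothing is left serves a final case where the count falls one short. *)
have eat2 (m : nat) X c0 c1 : m \in S -> par_closed (A :\: X) ->
    (forall x, x \in A -> x \in X -> near r c0 x \/ near m c1 x) ->
    r + m + 4 <= #|A :&: X| \/ A :\: X = set0 -> coverable (r :: S) A.
  move=> mS clX Xc cX; have mr := lt_r _ mS.
  have [c cP] : coverable (rem m S) (A :\: X).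
    case: cX => [cX|->]; last exact: coverable0.
    apply: IH => //; first by rewrite size_rem //; apply: leq_ltn_trans (leq_pred _) szS.
      exact: (subseq_sorted gtn_trans (rem_subseq _ _)).
    have := cardsID X A; move: cardA; rewrite (perm_big _ (perm_to_rem mS)) big_cons /=.
    nat_lia.
  exists (fun s => if s == r then c0 else if s == m then c1 else c s) => x xA.
  have [xX|xX] := boolP (x \in X).
    case: (Xc x xA xX) => near_x; first by exists r; rewrite ?mem_head ?eqxx.
    by exists m; rewrite ?in_cons ?mS ?orbT // ltn_eqF // eqxx.
  have [|s sS sx] := cP x; first by rewrite in_setD xX.
  move: sS; rewrite mem_rem_uniq // inE => /andP[/negPf sm sS].
  by exists s; rewrite ?in_cons ?sS ?orbT // sm ltn_eqF // lt_r.
have dtop y : d y = d l -> d (iter r par y) = d l - r by rewrite d_iter => ->.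
have [/existsP[y /and3P[yA /eqP dy big_y]]|tight] :=
    boolP [exists y in A, (d y == d l) && (r + 2 <= #|A :&: desc (iter r par y)|)].
  apply: (eat1 _ (iter r par y)) big_y => x xA xy; apply: near_desc => //.
  by rewrite dtop //; have := dmax x xA; nat_lia.
(* With [atleast], the branch at the [r]-th ancestor of every deepest vertex is a bare path of
   [r + 1] vertices. *)
have {}tight y : y \in A -> d y = d l -> #|A :&: desc (iter r par y)| <= r.+1.
  move=> yA dy; rewrite leqNgt; apply: contra tight => lt.
  by apply/existsP; exists y; rewrite yA dy eqxx addn2.
have atleast y : y \in A -> d y = d l -> r < #|A :&: desc (iter r par y)|.
  move=> yA dy; have := card_desc_gt Acl yA (iter_desc r y).
  by rewrite dtop // dy subKn // ltnW.
set v := iter r par l; pose p := par v.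
have dv : d v = d l - r by apply: dtop.
have dp : (d p).+1 = d v by rewrite d_par; nat_lia.
have pA : p \in A by rewrite Acl // par_closed_iter.
have lv : l \in desc v := iter_desc r l.
have lp : l \in desc p := desc_par lv.
have cardAp : #|A :&: desc p| <= #|A| by rewrite subset_leq_card // subsetIl.
(* For [r = 0] no other radius exists, so [A] has at most one vertex, yet it contains [l] and
   [p]. *)
have r0 : 0 < r.
  rewrite lt0n; apply/negP=> /eqP r_eq0; have := card_desc_gt Acl lA lp.
  have S_nil : S = [::].
    case: S lt_r {szS pathS sortS uS cardA eat1 eat2} => //= s S.
    by move/(_ s (mem_head _ _)); rewrite r_eq0.
  by move: cardA; rewrite S_nil big_nil; nat_lia.
have chain_near y x : y \in A -> d y = d l -> x \in A ->
    x \in desc (iter r par y) -> x = iter (d l - d x) par y.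
  move=> yA dy xA xy; rewrite -dy; apply: (desc_chain Acl yA (iter_desc r y)) => //.
  by rewrite dtop // dy (subKn (ltnW dl)) tight.
(* Without such an [x], the ball around [v] covers the whole branch at [p], which has at least
   [r + 2] vertices. *)
have [/existsP[x /and4P[xA xp xv dx]]|low] := boolP
    [exists x in A, [&& x \in desc p, x \notin desc v & (d l).-1 <= d x]]; last first.
  apply: (eat1 p v) => [x xA xp|]; last first.
    by have := card_desc_gt Acl lA lp; nat_lia.
  have [xv|xv] := boolP (x \in desc v).
    by apply: near_desc => //; have := dmax x xA; nat_lia.
  apply: near_desc_par => //; rewrite -/p ltnNge; apply: contra low => le_d.
  by apply/existsP; exists x; rewrite xA xp xv /=; nat_lia.
(* Is l the only deepest vertex below p? If not, use two bare paths below p. *)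
have [/existsP[y /and4P[yA yp yv /eqP dy]]|onlyl] := boolP
    [exists y in A, [&& y \in desc p, y \notin desc v & d y == d l]].
  pose w := iter r par y.
  have dw : d w = d v by rewrite dv; apply: dtop.
  have pw : par w = p.
    by rewrite -(desc_iter yp) dy /w -iterS; congr (iter _ par y); nat_lia.
  have wv : w != v by apply: contraNneq yv => <-; apply: iter_desc.
  have cardv := atleast l lA erefl; have cardw := atleast y yA dy.
  have cardp W : uniq W -> (forall u, u \in W -> par u = p /\ d u = d v) ->
      \sum_(u <- W) #|A :&: desc u| < #|A :&: desc p|.
    by move=> uW chW; apply: card_desc_children => // u /chW; rewrite dp.
  have := cardp [:: v; w]; rewrite /= !inE eq_sym wv !big_cons big_nil.
  move=> /(_ isT) cardp2.
  have {}cardp2 : r.*2 + 3 <= #|A :&: desc p|.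
    have : forall u, u \in [:: v; w] -> par u = p /\ d u = d v.
      by move=> u; rewrite !inE => /orP[] /eqP->.
    by move/cardp2; rewrite /v /w in cardv cardw *; nat_lia.
  (* From [v] through [p], radius [r] reaches all of the second path but its two lowest vertices; a
     ball of radius at least 1 at [y] takes these. *)
  have near_w x' (m : nat) : 0 < m -> x' \in A -> x' \in desc w ->
      near r v x' \/ near m y x'.
    move=> m0 x'A x'w; have [le1|gt1] := leqP (d l - d x') 1.
      right; exists 0, (d l - d x'); split; first by nat_lia.
      exact: chain_near.
    left; apply: near_desc_par; first by rewrite -/p -pw desc_par.
    by rewrite -/p; nat_lia.
  have near_v x' : x' \in A -> x' \in desc v -> near r v x'.
    by move=> x'A x'v; apply: near_desc => //; have := dmax x' x'A; nat_lia.
  (* The two paths have [2r + 2] vertices together, which is at least [r + m + 4] when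
     [m + 2 <= r]. *)
  have [/hasP[m mS /andP[m0 mr]]|nomid] :=
      boolP (has (fun m => (0 < m) && (m + 2 <= r)) S).
    apply: (eat2 m (desc v :|: desc w) v y) => //.
    - by rewrite -setDDl; do 2!apply: par_closedD.
    - move=> x' x'A; rewrite inE => /orP[/(near_v _ x'A)|]; first by left.
      exact: near_w.
    left; rewrite setIUr cardsU (_ : _ :&: _ :&: _ = set0) ?cards0; last first.
      apply/setP=> z; rewrite !(in_setI, in_set0); apply/negP.
      case/andP=> /andP[_ zv] /andP[_ zw].
      by rewrite (desc_same_depth dw zw zv) eqxx in wv.
    by rewrite /v /w in cardv cardw *; nat_lia.
  (* Otherwise r, r - 1 and 0 are the only radii, so A is barely larger than
     the two paths, and r and r - 1 cover the whole branch at p. *)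
  have S01 (s : nat) : s \in S -> s = 0 \/ s.+1 = r.
    move=> sS; have := lt_r s sS; move/hasPn/(_ s sS): nomid; nat_lia.
  have sum0 (S' : seq nat) : uniq S' -> {in S', forall s, s = 0} ->
      \sum_(s <- S') (s + 2) <= 2.
    case: S' => [|a [|b S']]; rewrite ?big_nil ?big_seq1 //.
      by move=> _ /(_ a (mem_head _ _)) ->.
    move=> + h; rewrite /= inE (h a) ?mem_head // (h b) ?eqxx //.
    by rewrite !inE eqxx orbT.
  (* Without [r - 1], the bound leaves [A] fewer than [r + 4] vertices, against at least [2r + 3]
     below [p]. *)
  have [rS|rS] := boolP (r.-1 \in S); last first.
    have : \sum_(s <- S) (s + 2) <= 2.
      by apply: sum0 => // s sS; case: (S01 s sS) rS => // <-; rewrite sS.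
    case: S {szS pathS sortS uS IH eat1 eat2 nomid rS} lt_r cardA S01 => [|s S] lt_r.
      by rewrite big_nil; nat_lia.
    by move=> cardA _; have := lt_r s (mem_head _ _); nat_lia.
  have sumS : \sum_(s <- S) (s + 2) <= r + 1 + 2 * (1 < r).
    rewrite (perm_big _ (perm_to_rem rS)) big_cons /=.
    have [r1|r1] := ltnP 1 r.
      apply: (@leq_trans (r.-1 + 2 + 2)); last by nat_lia.
      rewrite leq_add2l; apply: sum0 => [|s]; first exact: rem_uniq.
      rewrite mem_rem_uniq // inE => /andP[sr /S01]; nat_lia.
    have : rem r.-1 S = [::]; last by move=> ->; rewrite big_nil; nat_lia.
    case E: (rem r.-1 S) => [|s S'] //; have : s \in rem r.-1 S by rewrite E mem_head.
    by rewrite mem_rem_uniq // inE => /andP[sr /lt_r]; nat_lia.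
  apply: (eat2 r.-1 (desc p) v y) => //; first exact: par_closedD; last by left; nat_lia.
  (* For [r = 1], [A] would have fewer than 5 vertices, but the branch at [p] has at least 5. *)
  have r1 : 1 < r by case: ltnP sumS => // _; nat_lia.
  move=> z zA zp; have [zv|zv] := boolP (z \in desc v); first by left; apply: near_v.
  have [zw|zw] := boolP (z \in desc w); first by apply: near_w => //; nat_lia.
  (* A vertex too deep for [v] would give [p] a third child with at least [r] vertices below it;
     then [3r + 3 <= #|A| < 2r + 5], contradicting [1 < r]. *)
  left; apply: near_desc_par => //; rewrite -/p ltnNge; apply/negP=> dz.
  have [|u [pu du zu]] := desc_child zp; first by nat_lia.
  have cardu := card_desc_gt Acl zA zu.
  have := cardp [:: u; v; w]; rewrite /= !inE !big_cons big_nil.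
  have -> : (u == v) = false by apply: contraNF zv => /eqP <-.
  have -> : (u == w) = false by apply: contraNF zw => /eqP <-.
  rewrite eq_sym wv => /(_ isT) cardp3.
  have /cardp3 : forall u', u' \in [:: u; v; w] -> par u' = p /\ d u' = d v.
    by move=> u'; rewrite !inE => /or3P[] /eqP-> //; rewrite du dp.
  by rewrite /v /w in cardv cardw *; nat_lia.
(* This counts [p], the [r + 1] vertices below [v], and at least [r] below the child leading to
   [x]. *)
have cardp : r.*2 + 2 <= #|A :&: desc p|.
  have [|u [pu du xu]] := desc_child xp; first by nat_lia.
  have cardu := card_desc_gt Acl xA xu; have cardv := atleast l lA erefl.
  have uv : (u == v) = false by apply: contraNF xv => /eqP <-.
  have := @card_desc_children A p [:: u; v] pA.
  rewrite /= !inE uv !big_cons big_nil => /(_ isT).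
  have chW : forall u', u' \in [:: u; v] -> par u' = p /\ d u' = (d p).+1.
    by move=> u'; rewrite !inE => /orP[] /eqP->.
  by move=> /(_ chW); rewrite /v in cardv *; nat_lia.
(* Radius [r] around [p] misses only depth [d l], where [l] is alone, so any ball at [l] completes
   the cover, even one of radius 0. *)
have cover_p m z : z \in A -> z \in desc p -> near r p z \/ near m l z.
  move=> zA zp; have [dz|dz] := ltnP (d z) (d l).
    by left; apply: near_desc => //; nat_lia.
  have {}dz : d z = d l by apply/eqP; rewrite eqn_leq dmax.
  right; exists 0, 0; split=> //=; have [zv|zv] := boolP (z \in desc v).
    by rewrite (chain_near l z) // dz subnn.
  by move/negP: onlyl; case; apply/existsP; exists z; rewrite zA zp zv dz eqxx.
have [/hasP[m mS mr]|nosmall] := boolP (has (fun m => m + 2 <= r) S).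
  apply: (eat2 m (desc p) p l) => //; first exact: par_closedD; last by left; nat_lia.
  by move=> z zA zp; apply: cover_p.
(* Besides [r], only [r - 1] can be left. Then [#|A| <= 2r + 2], so [A] lies entirely below [p]. *)
case: S {szS pathS IH eat1} lt_r uS sortS cardA eat2 nosmall => [|s [|s' S]] lt_r.
- by rewrite big_nil; nat_lia.
- rewrite big_seq1 => _ _ cardA eat2 nosmall.
  have sr := lt_r s (mem_head _ _).
  apply: (eat2 s (desc p) p l); rewrite ?mem_head //; first exact: par_closedD.
    by move=> z zA zp; apply: cover_p.
  right; apply/eqP; rewrite -cards_eq0; have := cardsID (desc p) A; nat_lia.
move=> uS sortS _ _ /norP[].
have := lt_r s (mem_head _ _); have := lt_r s'; rewrite !inE eqxx orbT => /(_ isT).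
by move: sortS => /=; nat_lia.
Qed.

End RootedTree.

(** * From covers by balls to burning sequences *)

Section Burning.

Variables (T : finType) (e : rel T).
Implicit Types (B C : {set T}) (s : seq T).

Lemma spreadS B C : B \subset C -> spread e B \subset spread e C.
Proof.
move=> sBC; apply: setUSS => //; apply/subsetP=> v; rewrite !inE.
by move=> /'exists_andP[u [uB euv]]; apply/existsP; exists u; rewrite (subsetP sBC).
Qed.

Lemma sub_spread B : B \subset spread e B.
Proof. exact: subsetUl. Qed.

Lemma spread_edge B u v : u \in B -> e u v -> v \in spread e B.
Proof.
by move=> uB euv; rewrite !inE; apply/orP; right; apply/existsP; exists u; rewrite uB.
Qed.

Lemma iter_spreadS n B C :
  B \subset C -> iter n (spread e) B \subset iter n (spread e) C.
Proof. by move=> sBC; elim: n => //= n; apply: spreadS. Qed.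

Lemma sub_iter_spread m n B :
  m <= n -> iter m (spread e) B \subset iter n (spread e) B.
Proof.
move=> /subnK<-; elim: (n - m) => //= k IH.
exact: subset_trans IH (sub_spread _).
Qed.

Lemma sub_burned_from B s : iter (size s) (spread e) B \subset burned_from e B s.
Proof.
elim: s B => //= x s IH B; rewrite -iterS iterSr.
exact: subset_trans (iter_spreadS _ (subsetUl _ _)) (IH _).
Qed.

(** The source at index [i] still has [size s - i.+1] rounds in which to spread. *)
Lemma ball_sub_burned_from x0 B s i : i < size s ->
  iter (size s - i.+1) (spread e) [set nth x0 s i] \subset burned_from e B s.
Proof.
elim: s B i => // x s IH B [_|i] /=; last by rewrite ltnS subSS; apply: IH.
rewrite subSS subn0.
exact: subset_trans (iter_spreadS _ (subsetUr _ _)) (sub_burned_from _ _).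
Qed.

(* Sources that are already burned when their turn comes are replaced by
   arbitrary unburned vertices, and the sequence is cut when nothing is left. *)
Lemma valid_burning_of_cover B C s : B \subset C -> C != setT ->
    burned_from e B s = setT ->
  exists s', [/\ size s' <= size s, valid_from e C s', burned_from e C s' == setT
    & burned_from e C (take (size s').-1 s') != setT].
Proof.
elim: s B C => [|x s IH] B C sBC CnT /= burnT.
  by move: sBC CnT; rewrite burnT subTset => ->.
have [x' x'C x'x] : exists2 x', x' \notin C & (x' == x) || (x \in C).
  have [xC|xC] := boolP (x \in C); last by exists x; rewrite ?eqxx.
  have /subsetPn[y _ yC] : ~~ ([set: T] \subset C) by rewrite subTset.
  by exists y; rewrite ?orbT.
have sBC' : spread e B :|: [set x] \subset spread e C :|: [set x'].
  rewrite subUset (subset_trans (spreadS sBC)) ?subsetUl //= sub1set !inE.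
  by case/orP: x'x => [/eqP->|->]; rewrite ?eqxx ?orbT.
have [C'T|C'nT] := eqVneq (spread e C :|: [set x']) setT.
  by exists [:: x']; rewrite /= x'C C'T eqxx.
have [s' [szs' vs' bs' nbs']] := IH _ _ sBC' C'nT burnT.
exists (x' :: s'); rewrite /= x'C; split=> //.
by case: s' bs' nbs' {szs' vs'} => [/= bs'|y s' _]; first rewrite (eqP bs') eqxx in C'nT.
Qed.

(** The centre for radius [r] is placed at index [k - r - 1], and the resulting list is then
    repaired into a valid sequence. *)
Lemma burning_number_le (c : nat -> T) k : 0 < #|T| ->
    (forall x, exists2 r, r < k & x \in iter r (spread e) [set c r]) ->
  burning_number e <= k.
Proof.
move=> T0 cover; pose s := [seq c (k - i.+1) | i <- iota 0 k].
have szs : size s = k by rewrite size_map size_iota.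
have burns : burned_from e set0 s = setT.
  apply/eqP; rewrite -subTset; apply/subsetP=> x _; have [r rk xr] := cover x.
  have ik : k - r.+1 < k by lia.
  apply: (subsetP (ball_sub_burned_from x set0 (i := k - r.+1) _)); rewrite szs //.
  rewrite (nth_map 0) ?size_iota // nth_iota // add0n.
  by have -> : k - (k - r.+1).+1 = r by lia.
have [|s' [szs' vs' bs' nbs']] := valid_burning_of_cover (sub0set set0) _ burns.
  by rewrite eq_sym -card_gt0 cardsT.
have has_s' : has_burning_seq_of_length e (size s').
  by apply/existsP; exists (in_tuple s'); rewrite /burning_seq vs' bs' nbs'.
apply: leq_trans (_ : size s' <= k); last by rewrite -szs.
(* Were the result of [find] larger, [size s'] would lie in the searched range and have been
   rejected. *)
rewrite /burning_number leqNgt; apply/negP=> lt_find.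
have := before_find 0 lt_find; rewrite nth_iota ?add0n ?has_s' //.
by apply: leq_trans lt_find _; apply: leq_trans (find_size _ _) _; rewrite size_iota.
Qed.

End Burning.

(** * Rooting a connected graph by distance *)

Section Rooting.

Variables (T : finType) (e : rel T).

Lemma connect_spread x y : connect e x y -> exists n, y \in iter n (spread e) [set x].
Proof.
case/connectP=> p; elim/last_ind: p y => [|p z IH] y /=.
  by move=> _ ->; exists 0; rewrite inE.
rewrite rcons_path last_rcons => /andP[ep ez] ->.
have [n xn] := IH _ ep erefl; exists n.+1; exact: spread_edge xn ez.
Qed.

(** [d] is the distance to the root and [par] picks a neighbour one step closer. The root is its own
    parent, in accordance with the truncated predecessor. *)
Lemma rooting (root : T) : graph_connected e -> symmetric e ->
  exists (par : T -> T) (d : T -> nat),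
  [/\ forall x, d x = 0 -> x = root, forall x, d (par x) = (d x).-1, d root = 0
    & forall x, x != root -> e x (par x)].
Proof.
move=> conn sym.
pose P x n := x \in iter n (spread e) [set root].
have exP x : exists n, P x n by apply: connect_spread.
pose d x := ex_minn (exP x).
have dP x : P x (d x) by rewrite /d; case: ex_minnP.
have dmin x k : P x k -> d x <= k by rewrite /d; case: ex_minnP => n _; apply.
have d0 x : d x = 0 -> x = root by move: (dP x) => + dx; rewrite dx /P inE => /eqP.
have droot : d root = 0.
  by apply/eqP; rewrite -leqn0; apply: dmin; rewrite /P inE.
have step x : x != root -> exists u, e x u && (d u == (d x).-1).
  move=> xr; case dx: (d x) => [|n]; first by rewrite (d0 x dx) eqxx in xr.
  have xn : x \notin iter n (spread e) [set root].
    by apply/negP=> /dmin; rewrite dx ltnn.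
  have := dP x; rewrite dx /P /= !inE (negPf xn) /= => /existsP[u /andP[un eux]].
  exists u; rewrite sym eux eqn_leq dmin //= -ltnS -dx dmin //.
  exact: spread_edge (dP u) eux.
pose par x := if [pick u | e x u && (d u == (d x).-1)] is Some u then
  if x == root then x else u else x.
have parP x : x != root -> e x (par x) && (d (par x) == (d x).-1).
  move=> xr; rewrite /par (negPf xr); case: pickP => // none.
  by have [u] := step x xr; rewrite none.
exists par, d; split=> // x.
  have [->|/parP/andP[_ /eqP->]//] := eqVneq x root.
  by rewrite /par eqxx; case: pickP => [u _|_]; rewrite droot.
by case/parP/andP.
Qed.

End Rooting.

(** * Edges, degrees and internal vertices of a rooted tree *)

Section RootedGraph.

Variables (T : finType) (e : rel T) (par : T -> T) (d : T -> nat) (root : T).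
Hypothesis d_root : forall x, d x = 0 -> x = root.
Hypothesis d_par : forall x, d (par x) = (d x).-1.
Hypothesis d0 : d root = 0.
Hypothesis e_par : forall x, x != root -> e x (par x).
Hypotheses (e_sym : symmetric e) (e_irr : irreflexive e).

Lemma par_root : par root = root.
Proof. by apply: d_root; rewrite d_par d0. Qed.

Lemma par_spread (B : {set T}) x : x \in B -> par x \in spread e B.
Proof.
have [->|xr] := eqVneq x root; first by rewrite par_root; apply/subsetP/sub_spread.
by move/spread_edge; apply; apply: e_par.
Qed.

Lemma spread_par (B : {set T}) x : par x \in B -> x \in spread e B.
Proof.
have [->|xr] := eqVneq x root; first by rewrite par_root; apply/subsetP/sub_spread.
by move/spread_edge; apply; rewrite e_sym e_par.
Qed.

Lemma near_spread r c x : near par r c x -> x \in iter r (spread e) [set c].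
Proof.
case=> i [j [le_ij eq_ij]]; apply: (subsetP (sub_iter_spread _ _ le_ij)).
have : iter i par x \in iter j (spread e) [set c].
  rewrite eq_ij; elim: j {le_ij eq_ij} => [|j IH]; first by rewrite inE.
  exact: par_spread.
elim: i x {le_ij eq_ij} => // i IH x; rewrite iterSr => /IH.
exact: spread_par.
Qed.

(** The vertices [x] and [par (par x)] are two distinct neighbours of [par x]. *)
Lemma deg_par x : x != root -> par x != root -> 1 < deg e (par x).
Proof.
move=> xr pr; have neq : x != par (par x).
  apply/eqP=> /(congr1 d); rewrite !d_par => dx.
  by case/eqP: xr; apply: d_root; lia.
suff: [set x; par (par x)] \subset [set u | e (par x) u].
  by move/subset_leq_card; rewrite cards2 neq.
by apply/subsetP=> u; rewrite !inE => /orP[] /eqP->; rewrite ?e_par // e_sym e_par.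
Qed.

(* Deleting a non-tree edge leaves a connected graph, so that edge would close
   a cycle. *)
Lemma edge_par x y : acyclic e -> e x y -> par x = y \/ par y = x.
Proof.
move=> acyc exy; have [|pxy] := eqVneq (par x) y; first by left.
have [|pyx] := eqVneq (par y) x; first by right.
pose e' := [rel u v | e u v && ~~ ((u == x) && (v == y) || (u == y) && (v == x))].
have e'sym : symmetric e'.
  by move=> u v; rewrite /= e_sym orbC ![_ && (_ == x)]andbC ![_ && (_ == y)]andbC.
(* The deleted edge is no parent edge, so climbing to the root still works. *)
have conn z : connect e' z root.
  have [n] := ubnP (d z); elim: n z => // n IH z; rewrite ltnS => dz.
  have [->|zr] := eqVneq z root; first exact: connect0.
  have dz0 : 0 < d z by rewrite lt0n; apply: contra zr => /eqP/d_root->.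
  apply: connect_trans (connect1 _) (IH (par z) _); last by rewrite d_par; lia.
  rewrite /= e_par //=; apply/negP=> /orP[] /andP[/eqP zx /eqP]; rewrite zx; exact/eqP.
have : connect e' x y.
  by apply: connect_trans (conn x) _; rewrite (sym_connect_sym e'sym).
case/connectP=> p0 /shortenP[p e'p up _] yp.
have := acyc (x :: p) up; rewrite /cycle rcons_path -yp [e y x]e_sym exy andbT.
rewrite (sub_path _ e'p); last by move=> u v /andP[].
(* A path with a single edge would be the deleted edge; a longer one closes a cycle. *)
case: p e'p up yp => [|z [|z' p]] //=; last by move=> _ _ _ /(_ isT).
  by move=> _ _ yx; rewrite yx e_irr in exy.
by move=> + _ yz; rewrite -yz !eqxx /= andbF.
Qed.

Definition children x : {set T} := [set y | (y != root) && (par y == x)].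

(** Every vertex except the root is a child of exactly one vertex. *)
Lemma sum_children : (\sum_x #|children x|).+1 = #|T|.
Proof.
rewrite [RHS](cardD1 root) inE add1n -[in RHS]sum1_card; congr _.+1.
rewrite [RHS](partition_big par xpredT) //=.
by apply: eq_bigr => x _; rewrite -sum1_card; apply: eq_bigl => y; rewrite !inE andbT.
Qed.

Lemma deg_le_children x : acyclic e -> deg e x <= #|children x| + (x != root).
Proof.
move=> acyc; have sub : [set u | e x u] \subset
    children x :|: (if x == root then set0 else [set par x]).
  apply/subsetP=> u; rewrite inE => exu.
  case: (edge_par acyc exu) => [pxu|pux].
    case: eqVneq => [xr|_]; last by rewrite !inE pxu eqxx orbT.
    by move: exu; rewrite -pxu xr par_root e_irr.
  rewrite !inE pux eqxx andbT; case: eqVneq => // ur.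
  by move: exu; rewrite -pux ur par_root e_irr.
apply: leq_trans (subset_leq_card sub) _; apply: leq_trans (leq_card_setU _ _) _.
by rewrite leq_add2l; case: eqP => _; rewrite ?cards0 ?cards1.
Qed.

(** An internal vertex has at least two children, or one if its degree is 2; the root has one more
    in either case. Summing over [I] gives [2|I| + 1 <= (n - 1) + n_2]. *)
Lemma card_internal : acyclic e -> 1 < deg e root ->
  #|[set x | 1 < deg e x]|.*2 + 2 <= #|T| + n2 e.
Proof.
move=> acyc droot; set I := [set x | _].
have rI : root \in I by rewrite inE.
have : \sum_(x in I) (2 + (x == root)) <= \sum_(x in I) (#|children x| + (deg e x == 2)).
  apply: leq_sum => x; rewrite inE => dx; have := deg_le_children x acyc.
  by case: eqVneq => _ /=; case: eqVneq => /=; lia.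
rewrite !big_split /= sum_nat_const [\sum_(x in I) (x == root)](bigD1 root) //= eqxx.
rewrite big1 => [|x /andP[_ /negPf->]] //.
have : \sum_(x in I) #|children x| <= \sum_x #|children x|.
  by rewrite [X in _ <= X](bigID (mem I)) leq_addr.
have : \sum_(x in I) (deg e x == 2) <= n2 e.
  rewrite /n2 -sum1_card big_mkcond [X in _ <= X]big_mkcond leq_sum // => x _.
  by rewrite inE; case: ifP => //; case: ifP.
rewrite -sum_children.
move: (\sum_(x in I) #|children x|) (\sum_(x in I) (_ == 2)) (\sum_x _) => a b c.
by lia.
Qed.

End RootedGraph.

(** * The bound on the burning number in integer form *)

Lemma double_sum_radii j : (\sum_(s <- iota 0 j) (s + 2)).*2 = j * (j + 3).
Proof.
elim: j => [|j IH]; first by rewrite big_nil.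
by rewrite -addn1 iotaD big_cat big_seq1 /= doubleD IH; lia.
Qed.

Lemma tree_burning (T : finType) (e : rel T) k : is_tree e ->
  #|T| + n2 e < k ^ 2 + k -> burning_number e <= k.
Proof.
case=> -[e_sym e_irr] T0 conn acyc; case: k => [|j] // m_lt.
have [x0 _] := card_gt0P T0.
(* A root of maximum degree is internal as soon as any vertex is, so every parent lies in [I]. *)
have [root maxdeg] : exists root, forall x, deg e x <= deg e root.
  case: (arg_maxnP (deg e) (i0 := x0) (P := xpredT)) => // root _ maxdeg.
  by exists root => x; apply: maxdeg.
have [par [d [d_root d_par d0 e_par]]] := rooting root conn e_sym.
have near_ball r c x : near par r c x -> x \in iter r (spread e) [set c].
  exact: (near_spread d_root d_par d0 e_par e_sym).
have par_deg x : par x = root \/ 1 < deg e (par x).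
  have [|pr] := eqVneq (par x) root; [by left | right].
  apply: (deg_par d_root d_par d0 e_par e_sym) => //; apply: contraNneq pr => ->.
  by rewrite (par_root d_root d_par d0).
(* If no vertex is internal, every vertex is within distance 1 of the root; for [k = 1] the
   hypothesis forces a single vertex. *)
have [root_int|root_leaf] := ltnP 1 (deg e root); last first.
  have par_x x : par x = root.
    by case: (par_deg x) => // /leq_trans/(_ (maxdeg _)); rewrite ltnNge root_leaf.
  apply: (burning_number_le (c := fun=> root)) => // x.
  case: j m_lt => [|j] m_lt; last first.
    by exists 1 => //; apply: near_ball; exists 1, 0; rewrite /= par_x.
  have /card_le1_eqP T1 : #|T| <= 1 by lia.
  by exists 0 => //=; rewrite inE; apply/eqP/T1.
pose I := [set x | 1 < deg e x].
have parI x : par x \in I by rewrite inE; case: (par_deg x) => // ->.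
have cardI : #|I|.*2 + 2 <= #|T| + n2 e.
  exact: (card_internal d_root d_par d0 e_par e_sym e_irr acyc root_int).
have [||c cP] := tree_cover (S := rev (iota 0 j)) (A := I) d_root d_par
  _ (fun x _ => parI x).
- by rewrite rev_sorted; apply: iota_ltn_sorted.
- rewrite (perm_big _ (permEl (perm_rev _))) /=.
  by rewrite -ltn_double double_sum_radii; nia.
(* Radius [s] on [I] becomes [s + 1] on all vertices, as each parent is in [I]. *)
apply: (burning_number_le (c := fun r => c r.-1)) => // x.
have [s] := cP _ (parI x); rewrite mem_rev mem_iota add0n => /= sj near_s.
by exists s.+1 => //=; apply: (spread_par d_root d_par d0 e_par e_sym); apply: near_ball.
Qed.

(** * Eliminating the square roots and ceilings *)

Local Open Scope ring_scope.

(** Let [c] be the inner ceiling. Then [c + 1/2 < sqrt (m + 1/4)], so [c^2 + c < m]. If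
    [m >= k^2 + k], then [m - c <= k^2] forces [c >= k], whereas [c^2 < m - c <= k^2]. *)
Lemma lt_sqr_of_ceil_sqrt (R : realType) (m k : nat) :
    Num.sqrt (m%:R - (Num.ceil (Num.sqrt (m%:R + 1/4 : R) - 3/2))%:~R) <= k%:R :> R ->
  (m < k ^ 2 + k)%N.
Proof.
set c := Num.ceil _ => sqrt_le; rewrite ltnNge; apply/negP=> m_ge.
have m_le : m%:Z - c <= k%:Z ^+ 2.
  have : m%:R - c%:~R <= k%:R ^+ 2 :> R.
    (* A negative radicand has root 0 by convention, but is itself below [k^2]. *)
    have [le0|/ltW ge0] := lerP (m%:R - c%:~R : R) 0.
      exact: le_trans le0 (sqr_ge0 _).
    by rewrite -(sqr_sqrtr ge0) lerXn2r ?nnegrE ?sqrtr_ge0 ?ler0n.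
  by rewrite -(ler_int R) rmorphB rmorphXn /= !pmulrn.
have c_lt : c ^+ 2 + c < m%:Z.
  have c_ge0 : 0 <= c by nia.
  have := ceilB1_lt (Num.sqrt (m%:R + 1/4 : R) - 3/2); rewrite -/c rmorphB /= => lt_c.
  have c_ge0R : 0 <= c%:~R :> R by rewrite ler0z.
  have lt_c' : c%:~R + 1/2 < Num.sqrt (m%:R + 1/4) :> R by lra.
  have := ltrXn2r 2 _ lt_c'; rewrite sqr_sqrtr ?addr_ge0 ?divr_ge0 //.
  move=> /(_ isT) /= lt_sq; rewrite -(ltr_int R) rmorphD rmorphXn /= -pmulrn.
  by move: lt_sq; nra.
nia.
Qed.

Theorem theorem3 (R : realType) (T : finType) (e : rel T) :
  is_tree e ->
  let m : R := (#|T| + n2 e)%N%:R in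
  (burning_number e)%:Z <=
     Num.ceil (Num.sqrt (m - (Num.ceil (Num.sqrt (m + 1/4) - 3/2))%:~R)).
Proof.
move=> tree_e; cbv zeta; set m := _%:R; set z := Num.ceil (Num.sqrt _).
have z_ge : Num.sqrt (m - (Num.ceil (Num.sqrt (m + 1/4) - 3/2))%:~R) <= z%:~R.
  exact: ceil_ge.
have z_ge0 : 0 <= z by rewrite -(ler0z R) (le_trans (sqrtr_ge0 _) z_ge).
case: z z_ge z_ge0 => // k k_ge _; rewrite lez_nat.
by apply: tree_burning tree_e _; apply: (@lt_sqr_of_ceil_sqrt R).
Qed.
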